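(* Consider an ELLC function $f_i:\mathcal Z\subset\mathbb R^{n_z}\to\mathbb R$ (the $i$-th component of the vector field of a discrete-time (DT) or continuous-time (CT) system) with known Clarke-derivative bounds $a_{ij},b_{ij}$, $j\in\mathbb N_{n_z}$. Then $f_i$ admits a family of mixed-monotone remainder-form decomposition functions $\{f_{d,i}(z,\hat z;\mathbf m,h)\}_{\mathbf m\in\mathbf M_i,\ h\in\mathcal H_{\mathbf M_i}}$, parameterized by a supporting vector $\mathbf m\in\mathbf M_i$ and an ELLC remainder function $h\in\mathcal H_{\mathbf M_i}$, where $$f_{d,i}(z,\hat z;\mathbf m,h)=h(\zeta_{\mathbf m}(\hat z,z))+f_i(\zeta_{\mathbf m}(z,\hat z))-h(\zeta_{\mathbf m}(z,\hat z)),$$ with $\zeta_{\mathbf m}(z,\hat z)=[\zeta_{\mathbf m,1}(z,\hat z),\dots,\zeta_{\mathbf m,n_z}(z,\hat z)]^\top$. If the system is DT, then for all $j\in\mathbb N_{n_z}$ $$\zeta_{\mathbf m,j}(z,\hat z)=\begin{cases}\hat z_j,&\text{if }\mathbf m_j\ge\max(b_{ij},0),\\ z_j,&\text{if }\mathbf m_j\le\min(a_{ij},0),\end{cases}$$ $$\mathbf M_i=\{\mathbf m\in\mathbb R^{n_z}:\ \mathbf m_j\ge\max(b_{ij},0)\ \text{or}\ \mathbf m_j\le\min(a_{ij},0),\ \forall j\in\mathbb N_{n_z}\}.$$ If the system is CT, then $$\zeta_{\mathbf m,j}(z,\hat z)=\begin{cases}\hat z_j,&\text{if }\mathbf m_j\ge\max(b_{ij},0),\\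 z_j,&\text{if }\mathbf m_j\le\min(a_{ij},0),\\ x_i,&\text{if }j=i,\end{cases}$$ $$\mathbf M_i=\{\mathbf m\in\mathbb R^{n_z}:\ \mathbf m_j\ge\max(b_{ij},0)\ \text{or}\ \mathbf m_j\le\min(a_{ij},0),\ \forall j\in\mathbb N_{n_z},\,j\ne i,\ \ \mathbf m_i=0\}.$$ In both cases the set of remainder functions is the family of all ELLC functions whose Clarke sub-differential over $\mathcal Z$ is a subset of $\mathbf M_i$: $$\mathcal H_{\mathbf M_i}=\{h:\mathcal Z\to\mathbb R\ \text{ELLC}:\ [\underline J^h_C(z),\overline J^h_C(z)]\subseteq\mathbf M_i,\ \forall z\in\mathcal Z\}.$$ The resulting family of decomposition-based inclusion functions is $$T^{f_{d,i}}_{\underline{\mathbf m},\overline{\mathbf m}}(\mathbb I\mathcal Z)=[\,f_{d,i}(\underline z,\overline z;\underline{\mathbf m},\underline h),\ f_{d,i}(\overline z,\underline z;\overline{\mathbf m},\overline h)\,],\qquad \mathbb I\mathcal Z=[\underline z,\overline z],$$ for all $\underline{\mathbf m},\overline{\mathbf m}\in\mathbf M_i$ and the corresponding $\underline h,\overline h\in\mathcal H_{\mathbf M_i}$.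
   Context: Notation: $\mathbb N_n=\{1,\dots,n\}$; inequalities between vectors are componentwise; $[\underline z,\overline z]=\{z:\underline z\le z\le\overline z\}$. The system is $x_t^+=f(z_t)$ (a known input is suppressed), with $z_t=[x_t^\top\ w_t^\top]^\top\in\mathcal Z=\mathcal X\times\mathcal W\subset\mathbb R^{n_z}$, state $x_t\in\mathcal X\subset\mathbb R^{n_x}$, disturbance $w_t\in\mathcal W$, $f=(f_1,\dots,f_{n_x})$, where $x_t^+=x_{t+1}$ (DT) or $x_t^+=\dot x_t$ (CT). $x_i$ denotes the $i$-th state coordinate, i.e. the $i$-th coordinate of $z$. ELLC: $\varphi:\mathcal Z\to\mathbb R$ is either-sided locally Lipschitz continuous if for every $z\in\mathcal Z$ there are an open neighborhood $\mathcal N_z\subset\mathcal Z$ of $z$, a vector $\kappa\in\mathbb R^{n_z}$ with all entries nonzero, and $\rho\in\mathbb R$ such that $\langle\kappa(\varphi(z')-\varphi(z'')),z'-z''\rangle\le\rho\|z'-z''\|_2^2$ for all $z',z''\in\mathcal N_z$. Clarke derivatives: $(\overline J^{\varphi}_C(z))_j=\limsup_{t\to z,\lambda\downarrow0}\frac{\varphi(t+\lambda e_j)-\varphi(t)}{\lambda}$ and $(\underline J^{\varphi}_C(z))_j=\liminf_{t\to z,\lambda\downarrow0}\frac{\varphi(t+\lambda e_j)-\varphi(t)}{\lambda}$, with $e_j$ the $j$-th standard unit vector. Bounds: $a_{ij},b_{ij}\in\mathbb R\cup\{\pm\infty\}$ are known bounds on the Clarke derivatives of $f_i$, $a_{ij}\le(\underline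 J_C^{f_i}(z))_j$ and $(\overline J_C^{f_i}(z))_j\le b_{ij}$ for all $z\in\mathcal Z$, such that for each $j$, $b_{ij}<\infty$ or $a_{ij}>-\infty$. Decomposition function for $f_i$: a map $F:\mathcal Z\times\mathcal Z\to\mathbb R$ such that (1) $F(z,z)=f_i(z)$; (2) $F$ is nondecreasing in its first argument: $\tilde z\ge z\Rightarrow F(\tilde z,z')\ge F(z,z')$ (in the CT case only required when $\tilde z_i=z_i=x_i$); (3) $F$ is nonincreasing in its second argument: $\tilde z\ge z\Rightarrow F(z',\tilde z)\le F(z',z)$. Inclusion function for $f_i$: an interval-valued map $T$ with $f_i(\mathbb I\mathcal Z)\subset T(\mathbb I\mathcal Z)$ for every interval $\mathbb I\mathcal Z=[\underline z,\overline z]$ in the domain; in the CT case $\mathbb I\mathcal Z$ is replaced, for component $i$, by the interval with the same $j$-th coordinates for $j\ne i$ and with $\underline z_i=\overline z_i=x_i$.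
   Formalization: X and W are assumed to be products of intervals (otherwise the claim can fail or f_i at ζ_m is undefined), and ''corresponding h'' means the Clarke sub-differential of h lies, coordinatewise, in the branch of M_i selected by m (arbitrary pairs m, h make the claim false). *)

(* Defs.v *)
From HB Require Import structures.
From mathcomp Require Export all_boot all_order all_algebra.
From mathcomp Require Export all_classical all_reals all_analysis.

Set Implicit Arguments.
Unset Strict Implicit.
Unset Printing Implicit Defensive.

Export Order.TTheory GRing.Theory Num.Theory.
Export numFieldNormedType.Exports.

#[global] Open Scope classical_set_scope.
#[global] Open Scope ring_scope.

(* MathComp-Analysis, over an abstract R : realType.

   Functions on a domain Z of R^n are total functions on 'cV[R]_n of which only
   the values on Z matter: ELLC on Z forces Z to be open, and the Clarke
   derivatives at a point of Z depend only on values near that point. *)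

(* DT: x^+ = x_{t+1};  CT: x^+ = dx/dt. *)
Variant system := DT | CT.

(* In CT, when bounding the component f_i, the coordinate k of z which holds
   the state x_i plays a special role; in DT no coordinate does. *)
Definition is_state (n : nat) (s : system) (k j : 'I_n) : bool :=
  if s is CT then j == k else false.

Section Vectors.
Context {R : realType} {n : nat}.
Implicit Types (u v z : 'cV[R]_n).

Definition vle u v : Prop := forall j, u j 0 <= v j 0.

Definition vitv u v : set 'cV[R]_n := [set z | vle u z /\ vle z v].

Definition is_box (Z : set 'cV[R]_n) : Prop :=
  exists I : 'I_n -> interval R, Z = [set z | forall j, z j 0 \in I j].

Definition dot u v : R := \sum_(j < n) u j 0 * v j 0.

Definition unit_vec (j : 'I_n) : 'cV[R]_n := delta_mx j 0.

Definition set_coord (k : 'I_n) (x : R) z : 'cV[R]_n :=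
  \col_j if j == k then x else z j 0.

Definition ELLC (Z : set 'cV[R]_n) (phi : 'cV[R]_n -> R) : Prop :=
  forall z, Z z ->
    exists (N : set 'cV[R]_n) (kappa : 'cV[R]_n) (rho : R),
      [/\ open N, N z, N `<=` Z, (forall j, kappa j 0 != 0) &
          forall z' z'', N z' -> N z'' ->
            dot ((phi z' - phi z'') *: kappa) (z' - z'')
              <= rho * dot (z' - z'') (z' - z'')].

(* The difference quotient as a function of the pair p = (t, lambda). *)
Definition diff_quot (phi : 'cV[R]_n -> R) (j : 'I_n)
    (p : 'cV[R]_n * R) : \bar R :=
  ((phi (p.1 + p.2 *: unit_vec j) - phi p.1) / p.2)%:E.

Definition upper_clarke (phi : 'cV[R]_n -> R) z (j : 'I_n) : \bar R :=
  limf_esup (diff_quot phi j) (filter_prod (nbhs z) (at_right (0 : R))).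

Definition lower_clarke (phi : 'cV[R]_n -> R) z (j : 'I_n) : \bar R :=
  limf_einf (diff_quot phi j) (filter_prod (nbhs z) (at_right (0 : R))).

Definition clarke_subdiff (phi : 'cV[R]_n -> R) z : set ('I_n -> \bar R) :=
  [set v | forall j, (lower_clarke phi z j <= v j <= upper_clarke phi z j)%E].

(* S is a set of real vectors, so this forces the Clarke derivatives of phi to
   be finite on Z. *)
Definition subdiff_within (Z : set 'cV[R]_n) (phi : 'cV[R]_n -> R)
    (S : set 'cV[R]_n) : Prop :=
  forall z, Z z ->
    clarke_subdiff phi z `<=` [set (fun j => (m j 0)%:E) | m in S].

End Vectors.

Section RemainderForm.
Context {R : realType} {n : nat}.
(* a, b are the bounds a_ij, b_ij for a fixed i. *)
Variables (s : system) (k : 'I_n) (Z : set 'cV[R]_n) (fi : 'cV[R]_n -> R).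
Variables (a b : 'I_n -> \bar R).
Implicit Types (m z zh u v : 'cV[R]_n) (h : 'cV[R]_n -> R).

Definition ge_upper (x : R) (j : 'I_n) : bool :=
  (Order.max (b j) 0 <= x%:E)%E.

Definition le_lower (x : R) (j : 'I_n) : bool :=
  (x%:E <= Order.min (a j) 0)%E.

Definition supporting : set 'cV[R]_n :=
  [set m | forall j, if is_state s k j then m j 0 = 0
                     else ge_upper (m j 0) j \/ le_lower (m j 0) j].

Definition remainders : set ('cV[R]_n -> R) :=
  [set h | ELLC Z h /\ subdiff_within Z h supporting].

(* For m in [supporting] the last branch is the case m_j <= min(a_ij, 0).  Both
   this case and the preceding one hold only if m_j = 0 and a_ij >= 0 >= b_ij;
   then the first one is selected. *)
Definition zeta (x : R) m u v : 'cV[R]_n :=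
  \col_j if is_state s k j then x
         else if ge_upper (m j 0) j then v j 0 else u j 0.

(* The supporting set is a union of orthants, one for each choice of a branch
   in every coordinate of [zeta].  A remainder h corresponds to m when its
   Clarke sub-differential stays in the orthant selected by m.  This link is
   needed: for n = 1, f = id and a = b = 1 in DT, the supporting set is
   {m <= 0 or m >= 1}; taking m = 0 with h = 2 id yields 2 zh - z, which is
   decreasing in z. *)
Definition orthant m : set 'cV[R]_n :=
  [set v | forall j, ~~ is_state s k j ->
             if ge_upper (m j 0) j then ge_upper (v j 0) j
             else le_lower (v j 0) j].

Definition corresponding m h : Prop := subdiff_within Z h (orthant m).

(* In CT the state coordinate x_i is that of the first argument in all three
   terms. *)
Definition remainder_form m h z zh : R :=
  let x := z k 0 in
  h (zeta x m zh z) + fi (zeta x m z zh) - h (zeta x m z zh).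

Definition decomposition_function (F : 'cV[R]_n -> 'cV[R]_n -> R) : Prop :=
  [/\ forall z, Z z -> F z z = fi z,
      forall z zt z', Z z -> Z zt -> Z z' -> vle z zt ->
        (s = CT -> zt k 0 = z k 0) -> F z z' <= F zt z' &
      forall z zt z', Z z -> Z zt -> Z z' -> vle z zt -> F z' zt <= F z' z].

(* An interval [zl, zu] is passed to T through its endpoints. *)
Definition inclusion_function (T : 'cV[R]_n -> 'cV[R]_n -> interval R) : Prop :=
  forall zl zu, vle zl zu -> vitv zl zu `<=` Z ->
    match s with
    | DT => fi @` vitv zl zu `<=` [set` T zl zu]
    | CT => forall x : R, zl k 0 <= x <= zu k 0 ->
              let zl' := set_coord k x zl in
              let zu' := set_coord k x zu in
              fi @` vitv zl' zu' `<=` [set` T zl' zu']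
    end.

Definition decomposition_inclusion (ml mu : 'cV[R]_n) (hl hu : 'cV[R]_n -> R)
    (zl zu : 'cV[R]_n) : interval R :=
  `[remainder_form ml hl zl zu, remainder_form mu hu zu zl].

End RemainderForm.

Definition prod_domain (R : realType) (nx nw : nat)
    (X : set 'cV[R]_nx) (W : set 'cV[R]_nw) : set 'cV[R]_(nx + nw) :=
  [set z | X (usubmx z) /\ W (dsubmx z)].

(* Main.v *)
(* Although ELLC functions may jump, Clarke bounds control increments.  Suppose
   that at each point of a segment parallel to e_j, some real c is at least the
   upper Clarke derivative of phi along e_j and at most the lower one of psi.
   Then for every e > 0 the function psi - phi + e s of the position s is
   nondecreasing near each point of the segment, hence between its endpoints.
   Moving one coordinate at a time, this compares increments on a box.  For h
   corresponding to m, in the coordinates which zeta_m takes from its first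
   argument h is nonincreasing and f_i - h nondecreasing; in those taken from
   its second argument h is nondecreasing and f_i - h nonincreasing.  This is
   the mixed monotonicity of the remainder form.  The family is inhabited by
   the linear remainders h(z) = <m, z>. *)

Require Import Defs.
From mathcomp Require Import ring lra.

Set Implicit Arguments.
Unset Strict Implicit.
Unset Printing Implicit Defensive.

(** * Limits superior and inferior along a filter *)

Section LimSupInf.
Context {R : realType} {X : nbhsType}.
Implicit Types (f : X -> \bar R) (F : set_system X).

Lemma limf_esup_lt_near f F (x : \bar R) : Filter F ->
  (limf_esup f F < x)%E -> \forall y \near F, (f y < x)%E.
Proof.
move=> FF; rewrite limf_esupE => /ereal_inf_lt[_ [V FV <-]] ltx.
apply: filterS FV => y Vy; apply: le_lt_trans ltx.
by apply: ereal_sup_ubound; exists y.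
Qed.

Lemma limf_einf_gt_near f F (x : \bar R) : Filter F ->
  (x < limf_einf f F)%E -> \forall y \near F, (x < f y)%E.
Proof.
move=> FF; rewrite /limf_einf lteNr => /limf_esup_lt_near.
by apply: filterS => y; rewrite lteN2.
Qed.

Lemma limf_einf_le_esup f F : ProperFilter F ->
  (limf_einf f F <= limf_esup f F)%E.
Proof.
move=> FF; rewrite limf_einfE limf_esupE; apply: ge_ereal_sup => _ [V FV <-].
apply: le_ereal_inf_tmp => _ [W FW <-].
have [y [Vy Wy]] := filter_ex (filterI FV FW).
apply: (@le_trans _ _ (f y)); first by apply: ereal_inf_lbound; exists y.
by apply: ereal_sup_ubound; exists y.
Qed.

Lemma limf_near_cst f F (c : \bar R) : ProperFilter F ->
  (\forall y \near F, f y = c) -> limf_einf f F = c /\ limf_esup f F = c.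
Proof.
move=> FF Ffc.
have le_c : (limf_esup f F <= c)%E.
  rewrite limf_esupE.
  apply: (@le_trans _ _ (ereal_sup (f @` [set y | f y = c]))).
    by apply: ereal_inf_lbound; exists [set y | f y = c].
  by apply: ge_ereal_sup => _ [y /= -> <-].
have ge_c : (c <= limf_einf f F)%E.
  rewrite limf_einfE.
  apply: (@le_trans _ _ (ereal_inf (f @` [set y | f y = c]))).
    by apply: le_ereal_inf_tmp => _ [y /= -> <-].
  by apply: ereal_sup_ubound; exists [set y | f y = c].
have le_ie := limf_einf_le_esup f FF.
split; apply/eqP; rewrite eq_le.
  by rewrite ge_c (le_trans le_ie).
by rewrite le_c (le_trans ge_c).
Qed.

End LimSupInf.

(** Supremum argument: the set of [s] with [phi a <= phi s] can be extended beyond its supremum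
    through the local monotonicity there, unless the supremum is [b]. *)
Lemma locally_nondecreasing_le (R : realType) (phi : R -> R) (a b : R) :
  a <= b ->
  (forall s, a <= s <= b -> exists2 d, 0 < d &
     forall x y, s - d < x -> x <= y -> y < s + d -> phi x <= phi y) ->
  phi a <= phi b.
Proof.
move=> ab loc.
pose S := [set s | a <= s <= b /\ phi a <= phi s].
have Sa : S a by split=> //; rewrite lexx.
have supS : has_sup S by split; [exists a | exists b => s [/andP[]]].
have sup_itv : a <= sup S <= b.
  rewrite (ub_le_sup (proj2 supS)) //=.
  by apply: ge_sup; [exists a | move=> s [/andP[]]].
have [d d0 dP] := loc _ sup_itv.
have [s [/andP[sa sb] Ss] ltss] := sup_adherent d0 supS.
have [as_ bs_] := andP sup_itv.
have les : s <= sup S by apply: (ub_le_sup (proj2 supS)); split; rewrite ?sa.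
(* The half keeps [y] strictly inside the window of monotonicity around the supremum. As [y] lies in
   [S], it cannot exceed the supremum, which leaves only [y = b]. *)
pose y := Num.min b (sup S + d / 2).
have yb : y <= b by rewrite ge_min lexx.
have sy : sup S <= y by rewrite le_min bs_ /=; lra.
have yd : y <= sup S + d / 2 by rewrite ge_min lexx orbT.
have Sy : S y.
  split; first by rewrite yb andbT; lra.
  by apply: (le_trans Ss); apply: dP; lra.
have := ub_le_sup (proj2 supS) Sy.
move: Sy => [_]; rewrite /y /Num.min; case: ifP => //.
by move=> _ _; lra.
Qed.

(** * Comparing increments through Clarke derivatives *)

Section Clarke.
Context {R : realType} {n : nat}.
Implicit Types (phi psi : 'cV[R]_n -> R) (u v z : 'cV[R]_n) (j : 'I_n).

Lemma lower_le_upper_clarke phi z j :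
  (lower_clarke phi z j <= upper_clarke phi z j)%E.
Proof. exact: limf_einf_le_esup. Qed.

Lemma clarke_affine phi (c : R) z j :
  (forall t l, phi (t + l *: unit_vec j) = phi t + l * c) ->
  lower_clarke phi z j = c%:E /\ upper_clarke phi z j = c%:E.
Proof.
move=> phiE; apply: limf_near_cst.
have : \forall p \near filter_prod (nbhs z) (at_right (0 : R)), 0 < p.2.
  exists (setT, [set x : R | 0 < x]); last by move=> [t l] [].
  by split; [exact: filterT | exact: nbhs_right_gt].
apply: filterS => -[t l] /= l0; rewrite /diff_quot /= phiE addrAC subrr add0r.
by rewrite mulrAC divff ?mul1r // gt_eqF.
Qed.

Lemma clarke_zero z j :
  lower_clarke (fun=> 0 : R) z j = 0%:E /\
  upper_clarke (fun=> 0 : R) z j = 0%:E.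
Proof. by apply: clarke_affine => t l; rewrite mulr0 addr0. Qed.

(* Stronger than comparing the Clarke derivatives: the intermediate value must
   be finite. *)
Definition clarke_le phi psi z j : Prop :=
  exists c : R,
    (upper_clarke phi z j <= c%:E)%E /\ (c%:E <= lower_clarke psi z j)%E.

Lemma clarke_le_increment_line phi psi z j (L : R) : 0 <= L ->
  (forall s, 0 <= s <= L -> clarke_le phi psi (z + s *: unit_vec j) j) ->
  phi (z + L *: unit_vec j) - phi z <= psi (z + L *: unit_vec j) - psi z.
Proof.
move=> L0 le_pp; apply/ler_addgt0Pl => e e0.
(* Chosen so that [e' * L <= e], with a nonzero denominator even for [L = 0]. *)
pose e' := e / (L + 1).
have e'0 : 0 < e' by apply: divr_gt0 => //; lra.
pose g s := psi (z + s *: unit_vec j) - phi (z + s *: unit_vec j) + e' * s.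
suff : g 0 <= g L.
  rewrite /g scale0r addr0 mulr0 addr0.
  have : e' * L <= e.
    by rewrite /e' -mulrA ler_piMr ?(ltW e0) // mulrC ler_pdivrMr; lra.
  lra.
apply: locally_nondecreasing_le => // s /le_pp[c [upc clo]].
set q := z + s *: _ in upc clo.
(* The slope [e'] is split in two: near [q] the quotient of [phi] stays below [c + e' / 2] and that
   of [psi] above [c - e' / 2], so their difference never drops below [- e']. *)
have upF : \forall p \near filter_prod (nbhs q) (at_right (0 : R)),
    (diff_quot phi j p < (c + e' / 2)%:E)%E.
  by apply: limf_esup_lt_near; apply: (le_lt_trans upc); rewrite lte_fin; lra.
have loF : \forall p \near filter_prod (nbhs q) (at_right (0 : R)),
    ((c - e' / 2)%:E < diff_quot psi j p)%E.
  by apply: limf_einf_gt_near; apply: lt_le_trans clo; rewrite lte_fin; lra.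
have [[A B] /= [Aq B0] AB] := filterI upF loF.
have line_cvg : (fun x : R => z + x *: unit_vec j) @ s --> q.
  by apply: cvgD; [exact: cvg_cst | apply: cvgZr_tmp; exact: cvg_id].
have /nbhs_ballP[d1 /= d10 d1P] := line_cvg _ Aq.
have /nbhs_ballP[d2 /= d20 d2P] := B0.
(* Radius [d1] controls the base point [x]; the step [y - x] can be as long as twice the radius,
   whence the half of [d2]. *)
exists (Num.min d1 (d2 / 2)); first by rewrite lt_min d10 divr_gt0.
set d := Num.min _ _.
have dd1 : d <= d1 by rewrite ge_min lexx.
have dd2 : d <= d2 / 2 by rewrite ge_min lexx orbT.
move=> x y sx; rewrite le_eqVlt => /predU1P[->//|xy] ys.
have yx0 : 0 < y - x by lra.
have Ax : A (z + x *: unit_vec j).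
  by apply: d1P; rewrite /ball /= ltr_norml; apply/andP; split; lra.
have Byx : B (y - x).
  by apply: d2P => //; rewrite /ball /= ltr_norml; apply/andP; split; lra.
have [] := AB (_, _) (conj Ax Byx).
rewrite /diff_quot /= !lte_fin ltr_pdivrMr // ltr_pdivlMr //.
have -> : z + x *: unit_vec j + (y - x) *: unit_vec j = z + y *: unit_vec j.
  by rewrite -addrA -scalerDl addrCA subrr addr0.
rewrite /g; nra.
Qed.

(** The bounding points [u] and [v] may depend on the coordinate. Hence [Z] contains every mixture
    of coordinates of its points, and the paths parallel to the axes between them. *)
Definition box_closed (Z : set 'cV[R]_n) : Prop :=
  forall z,
    (forall j, exists u v, [/\ Z u, Z v & u j 0 <= z j 0 <= v j 0]) -> Z z.

Lemma box_closed_mix (Z : set 'cV[R]_n) z : box_closed Z ->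
  (forall j, exists2 u, Z u & z j 0 = u j 0) -> Z z.
Proof.
move=> boxZ mix; apply: boxZ => j; have [u Zu ->] := mix j.
by exists u, u; rewrite !lexx.
Qed.

Lemma clarke_le_increment (Z : set 'cV[R]_n) (P : pred 'I_n) phi psi u v :
  box_closed Z -> (forall z j, Z z -> P j -> clarke_le phi psi z j) ->
  Z u -> Z v -> vle u v -> (forall j, ~~ P j -> u j 0 = v j 0) ->
  phi v - phi u <= psi v - psi u.
Proof.
move=> boxZ le_pp Zu Zv uv uvP.
(* A staircase from [u] to [v] whose i-th step is parallel to one axis. *)
pose w (i : nat) : 'cV[R]_n := \col_j (if (j < i)%N then v j 0 else u j 0).
have Zw i : Z (w i).
  by apply: box_closed_mix => // j; rewrite mxE; case: ifP; [exists v | exists u].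
have w0 : w 0%N = u by apply/colP => j; rewrite mxE.
have wn : w n = v by apply/colP => j; rewrite mxE ltn_ord.
suff : forall i, (i <= n)%N -> phi (w i) - phi u <= psi (w i) - psi u.
  by move=> /(_ n (leqnn n)); rewrite wn.
elim=> [_|i IH lt_in]; first by rewrite w0 !subrr.
pose j := Ordinal lt_in.
have wS : w i.+1 = w i + (v j 0 - u j 0) *: unit_vec j.
  apply/colP => l; rewrite !mxE eqxx andbT ltnS leq_eqVlt -val_eqE /=.
  have [li|] := eqVneq (l : nat) i; last by rewrite mulr0 addr0.
  have -> : l = j by apply: val_inj.
  by rewrite ltnn /=; lra.
have := IH (ltnW lt_in).
suff : phi (w i.+1) - phi (w i) <= psi (w i.+1) - psi (w i) by lra.
(* Outside [P] the step has length zero and both increments vanish. *)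
rewrite wS; have [Pj|/uvP ->] := boolP (P j); last first.
  by rewrite subrr scale0r addr0 !subrr.
apply: clarke_le_increment_line => [|s /andP[s0 sL]]; first by rewrite subr_ge0.
apply: le_pp => //; apply: boxZ => l; exists (w i), (w i.+1); split=> //.
have := uv l; rewrite wS !mxE eqxx andbT.
have [->|] := eqVneq l j; last by rewrite !mulr0 !addr0 lexx.
by rewrite ltnn /=; lra.
Qed.

(** Compares increments with those of the zero function, taking 0 as the intermediate real. *)
Lemma clarke_nondecreasing (Z : set 'cV[R]_n) (P : pred 'I_n) phi u v :
  box_closed Z -> (forall z j, Z z -> P j -> (0 <= lower_clarke phi z j)%E) ->
  Z u -> Z v -> vle u v -> (forall j, ~~ P j -> u j 0 = v j 0) ->
  phi u <= phi v.
Proof.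
move=> boxZ ge0 Zu Zv uv uvP.
suff : (0 : R) - 0 <= phi v - phi u by lra.
apply: (@clarke_le_increment Z P (fun=> 0)) => // z j Zz Pj; exists 0.
have [_ ->] := clarke_zero z j.
by rewrite lexx ge0.
Qed.

Lemma clarke_nonincreasing (Z : set 'cV[R]_n) (P : pred 'I_n) phi u v :
  box_closed Z -> (forall z j, Z z -> P j -> (upper_clarke phi z j <= 0)%E) ->
  Z u -> Z v -> vle u v -> (forall j, ~~ P j -> u j 0 = v j 0) ->
  phi v <= phi u.
Proof.
move=> boxZ le0 Zu Zv uv uvP.
suff : phi v - phi u <= (0 : R) - 0 by lra.
apply: (@clarke_le_increment Z P phi (fun=> 0)) => // z j Zz Pj; exists 0.
have [-> _] := clarke_zero z j.
by rewrite lexx le0.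
Qed.

End Clarke.

(** * Linear remainders *)

Section LinearRemainder.
Context {R : realType} {n : nat}.
Implicit Types (m u v z : 'cV[R]_n).

Lemma dotB m u v : dot m (u - v) = dot m u - dot m v.
Proof.
by rewrite /dot -sumrB; apply: eq_bigr => j _; rewrite !mxE mulrBr.
Qed.

Lemma dot_line m u j (l : R) :
  dot m (u + l *: unit_vec j) = dot m u + l * m j 0.
Proof.
have -> : l * m j 0 = \sum_(i < n | i == j) l * m i 0 by rewrite big_pred1_eq.
rewrite /dot [X in _ = _ + X]big_mkcond -big_split; apply: eq_bigr => i _ /=.
by rewrite !mxE eqxx andbT; case: eqP => _ /=; ring.
Qed.

Lemma ELLC_dot (Z : set 'cV[R]_n) m : open Z -> ELLC Z (dot m).
Proof.
move=> oZ z Zz.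
(* With [kappa] all ones, the left side is the double sum of the [m_i d_i d_j], and each term is at
   most [|m_i|] times the squared norm of [d]. *)
exists Z, (const_mx 1), (\sum_(i < n) \sum_(j < n) `|m i 0|).
split=> // [j|z' z'' _ _]; first by rewrite mxE oner_neq0.
rewrite -dotB; move: (z' - z'') => d.
have -> : dot (dot m d *: const_mx 1) d =
    \sum_(i < n) \sum_(j < n) m i 0 * (d i 0 * d j 0).
  rewrite {1}/dot exchange_big /=; apply: eq_bigr => j _.
  by rewrite !mxE mulr1 /dot mulr_suml; apply: eq_bigr => i _; rewrite mulrA.
rewrite mulr_suml; apply: ler_sum => i _.
rewrite mulr_suml; apply: ler_sum => j _.
have sq_le l : d l 0 ^+ 2 <= dot d d.
  rewrite /dot (bigD1 l) //= -expr2 lerDl.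
  by apply: sumr_ge0 => l' _; rewrite -expr2 sqr_ge0.
apply: (le_trans (ler_norm _)); rewrite normrM ler_wpM2l //.
by rewrite ler_norml; apply/andP; split; have := sq_le i; have := sq_le j; nra.
Qed.

Lemma clarke_dot m z j :
  lower_clarke (dot m) z j = (m j 0)%:E /\ upper_clarke (dot m) z j = (m j 0)%:E.
Proof. by apply: clarke_affine => t l; exact: dot_line. Qed.

(** The two Clarke derivatives of a linear function coincide, so its sub-differential is the
    singleton of [m]. *)
Lemma subdiff_within_dot (Z S : set 'cV[R]_n) m :
  S m -> subdiff_within Z (dot m) S.
Proof.
move=> Sm z _ v vP; exists m => //; apply/funext => j; apply/eqP.
have := vP j; have [-> ->] := clarke_dot m z j.
by move=> /andP[le1 le2]; rewrite eq_le le1 le2.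
Qed.

End LinearRemainder.

(** * Open domains and boxes *)

Lemma ELLC_open (R : realType) (n : nat) (Z : set 'cV[R]_n) phi :
  ELLC Z phi -> open Z.
Proof.
move=> ellc; rewrite openE => z /ellc[N [_ [_ [oN Nz NZ _ _]]]].
by apply: filterS NZ _; exact: open_nbhs_nbhs.
Qed.

Lemma box_closed_box (R : realType) (n : nat) (Z : set 'cV[R]_n) :
  is_box Z -> box_closed Z.
Proof.
move=> [I ->] z zP j; have [u [v [/= uI vI uzv]]] := zP j.
exact: interval_is_interval (uI j) (vI j) _ uzv.
Qed.

Lemma box_closed_prod (R : realType) (nx nw : nat)
    (X : set 'cV[R]_nx) (W : set 'cV[R]_nw) :
  box_closed X -> box_closed W -> box_closed (prod_domain X W).
Proof.
move=> boxX boxW z zP; split.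
  apply: boxX => j; have [u [v [[Xu _] [Xv _] uzv]]] := zP (lshift nw j).
  by exists (usubmx u), (usubmx v); rewrite !mxE.
apply: boxW => j; have [u [v [[_ Wu] [_ Wv] uzv]]] := zP (rshift nx j).
by exists (dsubmx u), (dsubmx v); rewrite !mxE.
Qed.

(** * Mixed monotonicity of the remainder form *)

Section RemainderForm.
Context {R : realType} {n : nat}.
Variables (s : system) (k : 'I_n) (Z : set 'cV[R]_n) (fi : 'cV[R]_n -> R).
Variables (a b : 'I_n -> \bar R).
Hypothesis boxZ : box_closed Z.
Hypothesis lower_fi : forall z j, Z z -> (a j <= lower_clarke fi z j)%E.
Hypothesis upper_fi : forall z j, Z z -> (upper_clarke fi z j <= b j)%E.
Implicit Types (m u v z : 'cV[R]_n) (h : 'cV[R]_n -> R).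

(** In each coordinate one threshold is real: the comparison with 0 absorbs [b j = -oo] in the
    maximum and [a j = +oo] in the minimum. *)
Lemma supporting_nonempty :
  (forall j, (b j < +oo)%E \/ (-oo < a j)%E) -> exists m, supporting s k a b m.
Proof.
move=> fin.
have ex j : exists x : R, ge_upper b x j \/ le_lower a x j.
  have [bj|aj] := fin j.
    exists (fine (Order.max (b j) 0))%E; left; rewrite /ge_upper fineK //.
    by case: (b j) bj => [r| |] // _; rewrite ?maxNye // -EFin_max.
  exists (fine (Order.min (a j) 0))%E; right; rewrite /le_lower fineK //.
  by case: (a j) aj => [r| |] // _; rewrite ?minye // -EFin_min.
have [x xP] := choice ex.
exists (\col_j if is_state s k j then 0 else x j) => j; rewrite mxE.
by have := xP j; case: (is_state s k j).
Qed.

(** This is what makes the linear remainder [dot m] correspond to [m]. *)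
Lemma supporting_orthant m : supporting s k a b m -> orthant s k a b m m.
Proof.
move=> Mm j /negbTE nj; have := Mm j; rewrite nj.
by case: ifP => // _ [].
Qed.

(** The vectors of lower and of upper Clarke derivatives of [h] belong to its sub-differential, so
    they are real and lie in the orthant of [m]. Their entries supply both the sign and the
    intermediate real that [clarke_le] asks for. *)
Lemma corresponding_clarke m h z j :
  corresponding s k Z a b m h -> Z z -> ~~ is_state s k j ->
  if ge_upper b (m j 0) j
  then (0 <= lower_clarke h z j)%E /\ clarke_le fi h z j
  else (upper_clarke h z j <= 0)%E /\ clarke_le h fi z j.
Proof.
move=> corr Zz nj; case: ifP => mj.
  have [|m' om' lowerE] := corr z Zz (lower_clarke h z).
    by move=> l; rewrite lexx lower_le_upper_clarke.
  have := om' j nj; rewrite mj /ge_upper ge_max => /andP[bm m0].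
  rewrite -(congr1 (@^~ j) lowerE) /=; split=> //.
  exists (m' j 0); rewrite -(congr1 (@^~ j) lowerE) lexx.
  by split=> //; apply: le_trans bm; exact: upper_fi.
have [|m' om' upperE] := corr z Zz (upper_clarke h z).
  by move=> l; rewrite lexx lower_le_upper_clarke.
have := om' j nj; rewrite mj /le_lower le_min => /andP[ma m0].
rewrite -(congr1 (@^~ j) upperE) /=; split=> //.
exists (m' j 0); rewrite -(congr1 (@^~ j) upperE) lexx.
by split=> //; apply: (le_trans ma); exact: lower_fi.
Qed.

Lemma zeta_mem m u v z :
  Z u -> Z v -> Z z -> Z (zeta s k b (z k 0) m u v).
Proof.
move=> Zu Zv Zz; apply: box_closed_mix => // j; rewrite mxE.
case: ifP => [jk|_]; last by case: ifP; [exists v | exists u].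
by exists z => //; move: jk; rewrite /is_state; case: s => // /eqP ->.
Qed.

Lemma remainder_form_diag m h z : remainder_form s k fi b m h z z = fi z.
Proof.
have zetaE : zeta s k b (z k 0) m z z = z.
  apply/colP => j; rewrite mxE; case: ifP => [|_]; last by case: ifP.
  by rewrite /is_state; case: s => // /eqP ->.
by rewrite /remainder_form zetaE addrAC subrr add0r.
Qed.

Lemma zeta_le x m u u' v v' : vle u u' -> vle v v' ->
  vle (zeta s k b x m u v) (zeta s k b x m u' v').
Proof. by move=> uu' vv' j; rewrite !mxE; case: ifP => // _; case: ifP. Qed.

(** The state coordinate is in neither set: [zeta] freezes it, so it does not move in the
    comparisons below. *)
Definition from_first m : pred 'I_n :=
  [pred j | ~~ is_state s k j & ~~ ge_upper b (m j 0) j].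
Definition from_second m : pred 'I_n :=
  [pred j | ~~ is_state s k j & ge_upper b (m j 0) j].

Lemma remainder_form_decomposition m h :
  corresponding s k Z a b m h ->
  decomposition_function s k Z fi (remainder_form s k fi b m h).
Proof.
move=> corr.
have refl u : vle u u by move=> j.
have fst_eq x u u' v j : ~~ from_first m j ->
    zeta s k b x m u v j 0 = zeta s k b x m u' v j 0.
  by rewrite /from_first /= !mxE negb_and !negbK => /orP[->|->] //; case: ifP.
have snd_eq x u v v' j : ~~ from_second m j ->
    zeta s k b x m u v j 0 = zeta s k b x m u v' j 0.
  rewrite /from_second /= !mxE negb_and negbK => /orP[->//|/negbTE ->] //.
have fst_clarke z j : Z z -> from_first m j ->
    (upper_clarke h z j <= 0)%E /\ clarke_le h fi z j.
  move=> Zz /andP[nj /negbTE mj].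
  by have := corresponding_clarke corr Zz nj; rewrite mj.
have snd_clarke z j : Z z -> from_second m j ->
    (0 <= lower_clarke h z j)%E /\ clarke_le fi h z j.
  move=> Zz /andP[nj mj].
  by have := corresponding_clarke corr Zz nj; rewrite mj.
split=> [z _ | z zt z' Zz Zzt Zz' le_z kE | z zt z' Zz Zzt Zz' le_z].
- exact: remainder_form_diag.
- have -> : remainder_form s k fi b m h zt z' =
      h (zeta s k b (z k 0) m z' zt) + fi (zeta s k b (z k 0) m zt z')
      - h (zeta s k b (z k 0) m zt z').
    rewrite /remainder_form.
    suff E u v : zeta s k b (zt k 0) m u v = zeta s k b (z k 0) m u v.
      by rewrite !E.
    apply/colP => j; rewrite !mxE; case: ifP => //.
    by rewrite /is_state; move: kE; case: s => // ->.
  rewrite /remainder_form.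
  (* Raising [z] raises the second slot of the leading [h] and the first slot of [fi - h]; neither
     decreases. *)
  have := @clarke_nondecreasing _ _ Z (from_second m) h
    (zeta s k b (z k 0) m z' z) (zeta s k b (z k 0) m z' zt) boxZ
    (fun z j Zz Pj => proj1 (snd_clarke z j Zz Pj))
    (zeta_mem _ Zz' Zz Zz) (zeta_mem _ Zz' Zzt Zz)
    (zeta_le _ _ (refl _) le_z) (snd_eq _ _ _ _).
  have := @clarke_le_increment _ _ Z (from_first m) h fi
    (zeta s k b (z k 0) m z z') (zeta s k b (z k 0) m zt z') boxZ
    (fun z j Zz Pj => proj2 (fst_clarke z j Zz Pj))
    (zeta_mem _ Zz Zz' Zz) (zeta_mem _ Zzt Zz' Zz)
    (zeta_le _ _ le_z (refl _)) (fst_eq _ _ _ _).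
  lra.
(* The slots are exchanged: the leading [h] moves in its first slot and [fi - h] in its second, and
   neither increases. *)
- rewrite /remainder_form.
  have := @clarke_nonincreasing _ _ Z (from_first m) h
    (zeta s k b (z' k 0) m z z') (zeta s k b (z' k 0) m zt z') boxZ
    (fun z j Zz Pj => proj1 (fst_clarke z j Zz Pj))
    (zeta_mem _ Zz Zz' Zz') (zeta_mem _ Zzt Zz' Zz')
    (zeta_le _ _ le_z (refl _)) (fst_eq _ _ _ _).
  have := @clarke_le_increment _ _ Z (from_second m) fi h
    (zeta s k b (z' k 0) m z' z) (zeta s k b (z' k 0) m z' zt) boxZ
    (fun z j Zz Pj => proj2 (snd_clarke z j Zz Pj))
    (zeta_mem _ Zz' Zz Zz') (zeta_mem _ Zz' Zzt Zz')
    (zeta_le _ _ (refl _) le_z) (snd_eq _ _ _ _).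
  lra.
Qed.

End RemainderForm.

(** * From decomposition functions to inclusion functions *)

(** The chain is [Fl zl zu <= Fl zl z <= Fl z z = fi z], mirrored for [Fu]. In CT the equal state
    coordinates license the step in the first argument. *)
Lemma decomposition_bounds (R : realType) (n : nat) (s : system) (k : 'I_n)
    (Z : set 'cV[R]_n) (fi : 'cV[R]_n -> R) Fl Fu zl zu z :
  decomposition_function s k Z fi Fl -> decomposition_function s k Z fi Fu ->
  Z zl -> Z zu -> Z z -> vle zl z -> vle z zu ->
  (s = CT -> z k 0 = zl k 0 /\ z k 0 = zu k 0) ->
  Fl zl zu <= fi z <= Fu zu zl.
Proof.
move=> [diagl monol antil] [diagu monou antiu] Zl Zu Zz lz zu_ kE.
rewrite -{1}(diagl z Zz) -(diagu z Zz); apply/andP; split.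
  apply: (@le_trans _ _ (Fl zl z)); first exact: antil.
  by apply: monol => // /kE[].
apply: (@le_trans _ _ (Fu zu z)); last exact: antiu.
by apply: monou => // /kE[].
Qed.

Lemma set_coord_vitv (R : realType) (n : nat) (k : 'I_n) (x : R) u v :
  vle u v -> u k 0 <= x <= v k 0 ->
  vitv u v (set_coord k x u) /\ vitv u v (set_coord k x v).
Proof.
move=> uv /andP[ux xv].
by split; split => j; rewrite !mxE //; case: eqP => // ->.
Qed.

Lemma decomposition_inclusion_sound (R : realType) (n : nat) (s : system)
    (k : 'I_n) (Z : set 'cV[R]_n) (fi : 'cV[R]_n -> R) Fl Fu :
  decomposition_function s k Z fi Fl -> decomposition_function s k Z fi Fu ->
  inclusion_function s k Z fi (fun zl zu => `[Fl zl zu, Fu zu zl]).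
Proof.
move=> decl decu zl zu lezz subZ.
case: s decl decu => decl decu.
  move=> _ [z [lz zu_] <-] /=; rewrite in_itv /=.
  by apply: (decomposition_bounds decl decu) => //; apply: subZ; split.
move=> x xP /= _ [z [lz zu_] <-]; rewrite /= in_itv /=.
have [l_in u_in] := set_coord_vitv lezz xP.
(* Both endpoints have state coordinate [x], which pins that of [z]. *)
have zk : z k 0 = x.
  have := lz k; have := zu_ k; rewrite !mxE eqxx => zx xz.
  by apply/eqP; rewrite eq_le zx xz.
apply: (decomposition_bounds decl decu) => //; try exact: subZ.
  apply: subZ; split=> j.
    by apply: le_trans (lz j); case: l_in.
  by apply: (le_trans (zu_ j)); case: u_in.
by rewrite !mxE eqxx.
Qed.

Theorem theorem1 (R : realType) (nx nw : nat) (s : system)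
    (X : set 'cV[R]_nx) (W : set 'cV[R]_nw)
    (f : 'cV[R]_(nx + nw) -> 'cV[R]_nx)
    (a b : 'I_nx -> 'I_(nx + nw) -> \bar R) (i : 'I_nx) :
  let Z := prod_domain X W in
  let fi := fun z => f z i 0 in
  let k := lshift nw i in
  let M := supporting s k (a i) (b i) in
  let H := remainders s k Z (a i) (b i) in
  let corr := corresponding s k Z (a i) (b i) in
  let fd := remainder_form s k fi (b i) in
  let T := decomposition_inclusion s k fi (b i) in
  is_box X -> is_box W ->
  ELLC Z fi ->
  (forall z j, Z z -> (a i j <= lower_clarke fi z j)%E) ->
  (forall z j, Z z -> (upper_clarke fi z j <= b i j)%E) ->
  (forall j, (b i j < +oo)%E \/ (-oo < a i j)%E) ->
  [/\ exists m, M m,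
      forall m, M m -> exists h, H h /\ corr m h,
      forall m h, M m -> H h -> corr m h ->
        decomposition_function s k Z fi (fd m h) &
      forall ml mu hl hu, M ml -> M mu -> H hl -> H hu ->
        corr ml hl -> corr mu hu ->
        inclusion_function s k Z fi (T ml mu hl hu)].
Proof.
move=> Z fi k M H corr fd T boxX boxW ellc lower_fi upper_fi fin.
have boxZ : box_closed Z by apply: box_closed_prod; exact: box_closed_box.
have decomp m h : corr m h -> decomposition_function s k Z fi (fd m h).
  exact: remainder_form_decomposition.
split=> [|m Mm|m h _ _|ml mu hl hu _ _ _ _ corrl corru].
- exact: supporting_nonempty.
(* The linear remainder is the witness; [Z] is open because [fi] is ELLC on it. *)
- exists (dot m); split; last exact/subdiff_within_dot/supporting_orthant.
  by split; [exact/ELLC_dot/ELLC_open/ellc | exact: subdiff_within_dot].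
- exact: decomp.
- by apply: decomposition_inclusion_sound; exact: decomp.
Qed.
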